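(* Let $\bar x\in S$ be an isolated point of $S$. Suppose that $\nabla f(\bar x)d\ge0$ for all $d\in T_\Phi(\bar x)$, and there exists $\lambda\in\mathbb{R}^m$ with $\nabla_xL(\bar x,\lambda)=0$ such that for every $d\in C(\bar x)\setminus\{0\}$: (i) $\langle\lambda,v\rangle<0$ for all $v\in\nabla g(\bar x)\big(T''_\Phi(\bar x;d)\cap(\{d\}^\perp\setminus\{0\})\big)$; (ii) $\nabla^2_{xx}L(\bar x,\lambda)(d,d)-\sigma_{\nabla g(\bar x)(T^2_\Phi(\bar x;d)\cap\{d\}^\perp)+\nabla^2g(\bar x)(d,d)}(\lambda)>0$. Then $\bar x$ is a local second-order weak sharp minimizer of problem (P).
   Context: Standing setting: $f:\mathbb{R}^n\to\mathbb{R}$, $g:\mathbb{R}^n\to\mathbb{R}^m$ twice continuously differentiable, $K\subset\mathbb{R}^m$ closed; (P) is $\min f(x)$ s.t. $g(x)\in K$; $\Phi:=\{x:g(x)\in K\}$; $S$ is the (nonempty) set of optimal solutions; $L(x,\lambda):=f(x)+\langle g(x),\lambda\rangle$. $\bar x\in\Phi$ is a local second-order weak sharp minimizer if there are $\kappa,\delta>0$ with $f(x)\ge f(\bar x)+\kappa[\mathrm{dist}(x,S)]^2$ for all $x\in\Phi\cap B_\delta(\bar x)$. For a closed set $A$ and $\bar x\in A$: $T_A(\bar x):=\{d:\exists t_k\downarrow0,d_k\to d,\bar x+t_kd_k\in A\}$; for $d\in T_A(\bar x)$, $T^2_A(\bar x;d):=\{w:\exists t_k\downarrow0,w_k\to w,\bar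 x+t_kd+\tfrac12t_k^2w_k\in A\}$ and $T''_A(\bar x;d):=\{w:\exists(t_k,r_k)\downarrow(0,0),t_k/r_k\to0,w_k\to w,\bar x+t_kd+\tfrac12t_kr_kw_k\in A\}$. $C(x):=\{d:\nabla g(x)d\in T_K(g(x)),\nabla f(x)d\le0\}$. $\{d\}^\perp$ is the orthogonal complement of $d$; $\sigma_A(\lambda):=\sup_{u\in A}\langle\lambda,u\rangle$ ($-\infty$ if $A=\emptyset$); $\nabla^2g(x)(d,d):=(d^T\nabla^2g_i(x)d)_{i=1}^m$; $\nabla g(x)(A):=\{\nabla g(x)u:u\in A\}$. *)

(* Defs.v *)
From HB Require Import structures.
From mathcomp Require Import all_boot all_order all_algebra.
From mathcomp Require Import all_classical all_reals all_analysis.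
Set Implicit Arguments. Unset Strict Implicit. Unset Printing Implicit Defensive.
Import Order.TTheory GRing.Theory Num.Theory.
Import numFieldNormedType.Exports.
Local Open Scope classical_set_scope.
Local Open Scope ring_scope.

Section Defs.
Variable R : realType.

Definition dotv n (u v : 'rV[R]_n) : R := \sum_(i < n) u 0 i * v 0 i.

Definition grad n (h : 'rV[R]_n -> R) (x : 'rV[R]_n) : 'rV[R]_n :=
  \row_i ('d h x (delta_mx 0 i)).

Definition hess n (h : 'rV[R]_n -> R) (x : 'rV[R]_n) : 'M[R]_n :=
  \matrix_(i, j) ('d (grad h) x (delta_mx 0 j)) 0 i.

Definition quadf n (H : 'M[R]_n) (d : 'rV[R]_n) : R := (d *m H *m d^T) 0 0.

Definition C2 n (h : 'rV[R]_n -> R) : Prop :=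
  (forall x, differentiable h x) /\ (forall x, differentiable (grad h) x) /\
  continuous (hess h).

Definition compf n m (g : 'rV[R]_n -> 'rV[R]_m) (i : 'I_m) : 'rV[R]_n -> R :=
  fun x => g x 0 i.

Definition C2v n m (g : 'rV[R]_n -> 'rV[R]_m) : Prop := forall i, C2 (compf g i).

Definition hessg n m (g : 'rV[R]_n -> 'rV[R]_m) (x d : 'rV[R]_n) : 'rV[R]_m :=
  \row_i quadf (hess (compf g i) x) d.

Definition lagr n m (f : 'rV[R]_n -> R) (g : 'rV[R]_n -> 'rV[R]_m)
  (lam : 'rV[R]_m) : 'rV[R]_n -> R := fun x => f x + dotv (g x) lam.

Definition feas n m (g : 'rV[R]_n -> 'rV[R]_m) (K : set 'rV[R]_m) : set 'rV[R]_n :=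
  [set x | K (g x)].
Definition optset n m (f : 'rV[R]_n -> R) (g : 'rV[R]_n -> 'rV[R]_m)
  (K : set 'rV[R]_m) : set 'rV[R]_n :=
  [set x | feas g K x /\ forall y, feas g K y -> f x <= f y].

Definition distS n (x : 'rV[R]_n) (A : set 'rV[R]_n) : R :=
  inf [set `|x - y| | y in A].

Definition tcone n (A : set 'rV[R]_n) (x : 'rV[R]_n) : set 'rV[R]_n :=
  [set d | exists (t : nat -> R) (dk : nat -> 'rV[R]_n),
    (forall k, 0 < t k) /\ t @ \oo --> (0 : R) /\ dk @ \oo --> d /\
    (forall k, A (x + t k *: dk k))].

Definition tcone2 n (A : set 'rV[R]_n) (x d : 'rV[R]_n) : set 'rV[R]_n :=
  [set w | exists (t : nat -> R) (wk : nat -> 'rV[R]_n),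
    (forall k, 0 < t k) /\ t @ \oo --> (0 : R) /\ wk @ \oo --> w /\
    (forall k, A (x + t k *: d + (2^-1 * t k ^+ 2) *: wk k))].

Definition tcone2a n (A : set 'rV[R]_n) (x d : 'rV[R]_n) : set 'rV[R]_n :=
  [set w | exists (t r : nat -> R) (wk : nat -> 'rV[R]_n),
    (forall k, 0 < t k) /\ (forall k, 0 < r k) /\
    t @ \oo --> (0 : R) /\ r @ \oo --> (0 : R) /\
    (fun k => t k / r k) @ \oo --> (0 : R) /\ wk @ \oo --> w /\
    (forall k, A (x + t k *: d + (2^-1 * t k * r k) *: wk k))].

Definition critcone n m (f : 'rV[R]_n -> R) (g : 'rV[R]_n -> 'rV[R]_m)
  (K : set 'rV[R]_m) (x : 'rV[R]_n) : set 'rV[R]_n :=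
  [set d | tcone K (g x) ('d g x d) /\ 'd f x d <= 0].

(* support function sigma_A(lam), valued in extended reals (-oo on empty set) *)
Definition suppf m (A : set 'rV[R]_m) (lam : 'rV[R]_m) : \bar R :=
  ereal_sup [set (dotv lam u)%:E | u in A].

Definition wsharp2 n m (f : 'rV[R]_n -> R) (g : 'rV[R]_n -> 'rV[R]_m)
  (K : set 'rV[R]_m) (xb : 'rV[R]_n) : Prop :=
  feas g K xb /\
  exists kappa delta : R, 0 < kappa /\ 0 < delta /\
    forall x, feas g K x -> `|x - xb| <= delta ->
      f xb + kappa * (distS x (optset f g K)) ^+ 2 <= f x.

End Defs.

(* Main.v *)
Require Import Defs.
From HB Require Import structures.
From mathcomp Require Import all_boot all_order all_algebra.
From mathcomp Require Import all_classical all_reals all_analysis.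
From mathcomp Require Import ring lra.
Import Order.TTheory GRing.Theory Num.Theory.
Import numFieldNormedType.Exports.
Local Open Scope classical_set_scope.
Local Open Scope ring_scope.

(** Since the gradient of the Lagrangian vanishes at [xb], f'(xb) w = - <lam, g'(xb) w>, so
    (i) says f'(xb) w > 0 and (ii) gives f''(xb)(d,d) + f'(xb) w > 0: both hypotheses only
    concern f and the feasible set.  If quadratic growth fails there are feasible x_k -> xb
    with f(x_k) - f(xb) < |x_k - xb|^2 / (k + 1), and the directions of x_k - xb subconverge
    to a critical d.  Write x_k - xb = t_k (d + v_k) with v_k orthogonal to d.  Depending on
    whether v_k / t_k is bounded along a subsequence, v_k produces an element of T^2 or of
    T'' on which the second-order expansion of f contradicts (ii) or (i). *)

Set Implicit Arguments.
Unset Strict Implicit.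

(** * Subsequences and compactness in finite dimension *)

Section Sequences.
Variable R : realType.

(** The bound [k <= phi k] already forces [phi] to infinity, which is all that convergence along
    [phi] uses. *)
Lemma cvg_subseq (T : topologicalType) (u : nat -> T) (l : T) (phi : nat -> nat) :
  (forall k, (k <= phi k)%N) -> u @ \oo --> l -> (u \o phi) @ \oo --> l.
Proof.
move=> kphi ul; apply: cvg_comp ul.
move=> A [N _ NA]; exists N => // k /= Nk; apply: NA => /=.
exact: leq_trans Nk (kphi k).
Qed.

(** Bolzano-Weierstrass: the closed ball is compact, so the sequence has a cluster point [l], and
    [phi k] picks an index beyond [k] at which [u] is within 1/(k+1) of [l]. *)
Lemma bounded_rV_cvg_subseq n (u : nat -> 'rV[R]_n) (M : R) :
  (forall k, `|u k| <= M) ->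
  exists (phi : nat -> nat) (l : 'rV[R]_n),
    (forall k, (k <= phi k)%N) /\ (u \o phi) @ \oo --> l.
Proof.
move=> uM.
have cB : compact [set x : 'rV[R]_n | `|x| <= M].
  apply: bounded_closed_compact.
    exists M; split; first exact: num_real.
    by move=> y My x /= xM; apply: le_trans xM (ltW My).
  apply: (@closed_comp _ _ (fun x : 'rV[R]_n => `|x|) [set r : R | r <= M]).
    by move=> x _; exact: norm_continuous.
  exact: closed_le.
have [l [_ ul]] : [set x : 'rV[R]_n | `|x| <= M] `&` cluster (u @ \oo) !=set0.
  by apply: cB; exists 0%N => // k _; exact: uM.
have phiP k : exists j, (k <= j)%N /\ `|l - u j| < k.+1%:R^-1.
  have uk : (u @ \oo) (u @` [set j | (k <= j)%N]) by exists k => // j kj; exists j.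
  have lk : nbhs l (ball l k.+1%:R^-1) by apply: nbhsx_ballx; rewrite invr_gt0.
  have [_ [[j kj <-] /=]] := ul _ _ uk lk.
  by rewrite -ball_normE /= => lu; exists j.
have [phi phiE] := choice phiP.
exists phi, l; split=> [k|]; first by case: (phiE k).
apply/cvgrPdist_lt => e e0; near=> k.
apply: lt_trans (phiE k).2 _.
by near: k; exact: near_infty_natSinv_lt (PosNum e0).
Unshelve. all: by end_near. Qed.

End Sequences.

(** * The inner product and its continuity *)

Section DotProduct.
Variables (R : realType) (n : nat).
Implicit Types u v w : 'rV[R]_n.

Lemma dotvC u v : dotv u v = dotv v u.
Proof. by apply: eq_bigr => i _; rewrite mulrC. Qed.

Lemma dotvDl u v w : dotv (u + v) w = dotv u w + dotv v w.
Proof. by rewrite -big_split; apply: eq_bigr => i _; rewrite mxE mulrDl. Qed.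

Lemma dotvZl a u w : dotv (a *: u) w = a * dotv u w.
Proof. by rewrite mulr_sumr; apply: eq_bigr => i _; rewrite mxE mulrA. Qed.

Lemma dotvNl u w : dotv (- u) w = - dotv u w.
Proof. by rewrite -scaleN1r dotvZl mulN1r. Qed.

Lemma dotv_gt0 u : u != 0 -> 0 < dotv u u.
Proof.
move=> u0; rewrite lt_def sumr_ge0 ?andbT => [|i _]; last by rewrite -expr2 sqr_ge0.
apply: contra u0; rewrite psumr_eq0 => [/allP ue|i _]; last by rewrite -expr2 sqr_ge0.
apply/eqP/rowP => i; rewrite mxE.
by have /implyP/(_ isT) := ue i (mem_index_enum i); rewrite mulf_eq0 orbb => /eqP.
Qed.

Lemma normr_coord u i : `|u 0 i| <= `|u|.
Proof.
rewrite /Num.Def.normr /= mx_normrE.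
exact: (le_bigmax _ (fun ij : 'I_1 * 'I_n => `|u ij.1 ij.2|) (0, i)).
Qed.

(** The norm on row vectors is the max norm, so the coordinatewise bound costs a factor [n]. *)
Lemma normr_dotv_le u v : `|dotv u v| <= n%:R * (`|u| * `|v|).
Proof.
apply: le_trans (ler_norm_sum _ _ _) _.
rewrite mulr_natl -[X in _ *+ X]card_ord -sumr_const; apply: ler_sum => i _.
by rewrite normrM ler_pM// normr_coord.
Qed.

Lemma cvg_coord (T : Type) (F : set_system T) {FF : Filter F}
    (a : T -> 'rV[R]_n) u i :
  a @ F --> u -> (fun x => a x 0 i) @ F --> u 0 i.
Proof.
by move=> au; apply: (cvg_comp a (fun z : 'rV[R]_n => z 0 i) au) => A;
  exact: coord_continuous.
Qed.

Lemma cvg_dotv (T : Type) (F : set_system T) {FF : Filter F}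
    (a b : T -> 'rV[R]_n) u v :
  a @ F --> u -> b @ F --> v -> (fun x => dotv (a x) (b x)) @ F --> dotv u v.
Proof.
move=> au bv.
have -> : (fun x => dotv (a x) (b x)) = \sum_(i < n) (fun x => a x 0 i * b x 0 i).
  by apply/funext => x; rewrite fct_sumE.
apply: (big_ind2 (fun (q : T -> R) (l : R) => q @ F --> l)) => [|p r q l pr ql|i _].
- exact: cvg_cst.
- exact: cvgD.
by apply: cvgM; exact: cvg_coord.
Qed.

Lemma dotv_cvg_eq0 (u : nat -> 'rV[R]_n) v w :
  (forall k, dotv (u k) w = 0) -> u @ \oo --> v -> dotv v w = 0.
Proof.
move=> uw uv.
have uwv : (fun k => dotv (u k) w) @ \oo --> dotv v w.
  by apply: cvg_dotv => //; exact: cvg_cst.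
apply/eqP; rewrite eq_le; apply/andP; split.
  by apply: (cvgr_to_le uwv); apply: nearW => k; rewrite uw.
by apply: (cvgr_to_ge uwv); apply: nearW => k; rewrite uw.
Qed.

End DotProduct.

(** * Gradient, Hessian and second-order Taylor expansion *)

Section Derivatives.
Variable R : realType.

Lemma diff_dotv_grad n (h : 'rV[R]_n -> R) x u : 'd h x u = dotv (grad h x) u.
Proof.
rewrite {1}[u]row_sum_delta linear_sum /=.
by apply: eq_bigr => i _; rewrite linearZ /= mxE mulrC.
Qed.

(** Trades the Hessian matrix for the derivative of the gradient, whose first-order remainder can be
    estimated. *)
Lemma quadf_hess n (h : 'rV[R]_n -> R) x u :
  quadf (hess h x) u = dotv ('d (grad h) x u) u.
Proof.
rewrite /quadf -mulmxA mxE; apply: eq_bigr => i _; rewrite mulrC; congr (_ * _).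
rewrite {2}[u]row_sum_delta linear_sum /= summxE mxE.
by apply: eq_bigr => j _; rewrite linearZ !mxE mulrC.
Qed.

Lemma differentiable_remainder (V W : normedModType R) (F : V -> W) x e :
  differentiable F x -> 0 < e ->
  \forall h \near 0, `|F (h + x) - F x - 'd F x h| <= e * `|h|.
Proof.
move=> dF e0; near=> h; rewrite (diff_locallyx dF) -(addrA (F x)) [F x + _]addrC addrK.
rewrite addrAC subrr add0r.
by near: h; exact: littleoP.
Unshelve. all: by end_near. Qed.

(** The difference quotients of the restriction to the line are those of the directional derivative
    of [F] along [u]. *)
Lemma is_derive_line (V W : normedModType R) (F : V -> W) (x u : V) (s : R) :
  differentiable F (s *: u + x) ->
  is_derive s 1 (fun t : R => F (t *: u + x)) ('d F (s *: u + x) u).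
Proof.
move=> dF.
have E : (fun t : R => t^-1 *: (((fun r : R => F (r *: u + x)) \o shift s) (t *: 1)
      - F (s *: u + x))) =
    (fun t : R => t^-1 *: ((F \o shift (s *: u + x)) (t *: u) - F (s *: u + x))).
  by apply/funext => t /=; rewrite [t *: 1]mulr1 scalerDl addrA.
split; first by rewrite /derivable E; exact: diff_derivable.
by rewrite /derive E -deriveE.
Qed.

(* Mean value theorem for s |-> h (x + s u) - s h'(x) u - s^2 h''(x)(u,u) / 2 on [0,1]. *)
Lemma taylor2 n (h : 'rV[R]_n -> R) x e : C2 h -> 0 < e ->
  \forall u \near (0 : 'rV[R]_n),
    `|h (u + x) - h x - 'd h x u - 2^-1 * quadf (hess h x) u| <= e * `|u| ^+ 2.
Proof.
move=> [dh [dgh _]] e0.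
(* This absorbs the factor [n] of [normr_dotv_le]; the successor keeps the division valid for n =
   0. *)
have e'0 : 0 < e / n.+1%:R by rewrite divr_gt0.
have /nbhs_ballP[r /= r0 rP] := differentiable_remainder (dgh x) e'0.
apply/nbhs_ballP; exists r => // u; rewrite -ball_normE /= sub0r normrN => ur.
set a := 'd h x u; set q := quadf (hess h x) u.
pose psi (s : R) := h (s *: u + x) - (s * a + 2^-1 * q * s ^+ 2).
pose dpsi (s : R) := 'd h (s *: u + x) u - a - s * q.
have dpsiE (s : R) : is_derive s 1 psi (dpsi s).
  have dl := is_derive_line (dh (s *: u + x)).
  have -> : psi = (fun t : R => h (t *: u + x)) - (a *: id + (2^-1 * q) *: (id * id)).
    by apply/funext => t; rewrite /psi expr2 [t * a]mulrC.
  have did := is_derive_id s (1 : R).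
  have := is_deriveB dl (is_deriveD (is_deriveZ a did)
    (is_deriveZ (2^-1 * q) (is_deriveM did did))).
  congr (is_derive _ _ _ _).
  rewrite /dpsi -addrA -opprD; congr (_ - (_ + _)); first exact: mulr1.
  rewrite -[s *: 1]/(s * 1) -[(_ * q) *: _]/(_ * _).
  by field.
have [s /[!in_itv]/= /andP[s0 s1]] := @MVT R psi dpsi 0 1 ltr01 (fun s _ => dpsiE s)
  (derivable_within_continuous (fun s _ => @ex_derive _ _ _ _ _ _ _ (dpsiE s))).
rewrite subr0 mulr1 /psi scale1r scale0r add0r.
have -> : h (u + x) - (1 * a + 2^-1 * q * 1 ^+ 2) - (h x - (0 * a + 2^-1 * q * 0 ^+ 2)) =
   h (u + x) - h x - a - 2^-1 * q by ring.
move=> ->.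
(* The derivative of [psi] is the first-order remainder of the gradient at s u, paired with u;
   differentiability of [grad h] makes it small. *)
have -> : dpsi s =
    dotv (grad h (s *: u + x) - grad h x - 'd (grad h) x (s *: u)) u.
  rewrite 2!dotvDl 2!dotvNl; congr (_ - _ - _); [exact: diff_dotv_grad..|].
  by rewrite linearZ dotvZl /q quadf_hess.
apply: le_trans (normr_dotv_le _ _) _.
have sur : `|s *: u| <= `|u| by rewrite normrZ gtr0_norm // ler_piMl // ltW.
have /rP : ball 0 r (s *: u).
  by rewrite -ball_normE /= sub0r normrN; exact: le_lt_trans sur ur.
set z := grad h _ - _ - _ => /= zle.
have {}zle : `|z| <= e / n.+1%:R * `|u|.
  by apply: le_trans zle _; rewrite ler_wpM2l // ltW.
have : n%:R * (`|z| * `|u|) <= n.+1%:R * ((e / n.+1%:R * `|u|) * `|u|).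
  by rewrite ler_pM // ?ler_nat // ?mulr_ge0 // ler_wpM2r.
move=> /le_trans; apply.
by rewrite -!mulrA mulrCA [_ * (_^-1 * _)]mulVKf ?pnatr_eq0 // -expr2.
Qed.

End Derivatives.

(** * Limits of difference quotients along varying directions *)

Lemma cvg_to_ext (T : Type) (U : topologicalType) (u v : T -> U)
    (F : set_system T) (l : U) :
  v =1 u -> u @ F --> l -> v @ F --> l.
Proof. by move=> /funext ->. Qed.

Section Expansions.
Variable R : realType.

(** Since [dk] is eventually bounded by some M, a remainder below (e / M^p) |u|^p at u = t d_k is at
    most e t^p. The cases p = 1 and p = 2 serve the two expansions below. *)
Lemma cvg_scaled_remainder (V W : normedModType R) (rem : V -> W) (p : nat)
    (t : nat -> R) (dk : nat -> V) (d : V) :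
  (forall e, 0 < e -> \forall u \near 0, `|rem u| <= e * `|u| ^+ p) ->
  (forall k, 0 < t k) -> t @ \oo --> (0 : R) -> dk @ \oo --> d ->
  (fun k => (t k ^+ p)^-1 *: rem (t k *: dk k)) @ \oo --> (0 : W).
Proof.
move=> remP t0 tto0 dkd; apply/cvgr0Pnorm_le => e e0.
pose M := `|d| + 1.
have M0 : 0 < M by rewrite ltr_wpDl.
have tdk0 : (fun k => t k *: dk k) @ \oo --> (0 : V).
  by rewrite -(scale0r d); exact: cvgZ.
have eM : 0 < e / M ^+ p by rewrite divr_gt0 // exprn_gt0.
have remk := tdk0 _ (remP _ eM).
near=> k.
have dM : `|dk k| <= M.
  by near: k; apply: cvgr_norm_le dkd _ _; rewrite ltrDl.
have tp0 : 0 < t k ^+ p by rewrite exprn_gt0.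
rewrite normrZ normfV (gtr0_norm tp0) ler_pdivrMl //.
have : `|rem (t k *: dk k)| <= e / M ^+ p * `|t k *: dk k| ^+ p by near: k.
move=> /le_trans; apply.
rewrite normrZ gtr0_norm // exprMn mulrCA ler_pM2l //.
rewrite -mulrA ger_pMr // ler_pdivrMl ?exprn_gt0 // mulr1.
by apply: lerXn2r dM; rewrite nnegrE // ltW.
Unshelve. all: by end_near. Qed.

Lemma cvg_diff_quotient (V W : normedModType R) (F : V -> W) (x : V)
    (t : nat -> R) (dk : nat -> V) (d : V) :
  differentiable F x ->
  (forall k, 0 < t k) -> t @ \oo --> (0 : R) -> dk @ \oo --> d ->
  (fun k => (t k)^-1 *: (F (x + t k *: dk k) - F x)) @ \oo --> 'd F x d.
Proof.
move=> dF t0 tto0 dkd.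
pose rem u := F (u + x) - F x - 'd F x u.
have remP e : 0 < e -> \forall u \near 0, `|rem u| <= e * `|u| ^+ 1.
  by move=> e0; exact: differentiable_remainder.
have cd : 'd F x (dk k) @[k --> \oo] --> 'd F x d.
  exact: (cvg_comp dk ('d F x) dkd (@diff_continuous _ _ _ _ _ dF d)).
have := @cvgD _ _ _ \oo eventually_filter _ _ _ _
  (cvg_scaled_remainder remP t0 tto0 dkd) cd.
rewrite add0r => lim; refine (cvg_to_ext _ lim) => k.
rewrite /rem !fctE expr1 [x + _]addrC linearZ [in RHS]scalerBr /= scalerA.
by rewrite mulVf ?gt_eqF // scale1r subrK.
Qed.

(** The linear term is evaluated at [dk k] rather than at [d], because h'(x)(d_k - d) / t_k need not
    tend to 0. *)
Lemma cvg_diff2_quotient n (h : 'rV[R]_n -> R) (x : 'rV[R]_n)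
    (t : nat -> R) (dk : nat -> 'rV[R]_n) (d : 'rV[R]_n) :
  C2 h ->
  (forall k, 0 < t k) -> t @ \oo --> (0 : R) -> dk @ \oo --> d ->
  (fun k => (t k ^+ 2)^-1 * (h (x + t k *: dk k) - h x - t k * 'd h x (dk k))) @ \oo
    --> 2^-1 * quadf (hess h x) d.
Proof.
move=> Ch t0 tto0 dkd.
pose rem (u : 'rV[R]_n) := h (u + x) - h x - 'd h x u - 2^-1 * quadf (hess h x) u.
have remP e : 0 < e -> \forall u \near (0 : 'rV[R]_n), `|rem u| <= e * `|u| ^+ 2.
  by move=> e0; exact: taylor2.
have cg : 'd (grad h) x (dk k) @[k --> \oo] --> 'd (grad h) x d.
  apply: (cvg_comp dk ('d (grad h) x) dkd).
  by apply: (@diff_continuous _ _ _ _ _ _ d); case: Ch => _ [].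
have cq : (fun k => 2^-1 * quadf (hess h x) (dk k)) @ \oo --> 2^-1 * quadf (hess h x) d.
  apply: cvgMl_tmp; rewrite quadf_hess.
  have -> : (fun k => quadf (hess h x) (dk k)) =
     (fun k => dotv ('d (grad h) x (dk k)) (dk k)).
    by apply/funext => k; exact: quadf_hess.
  exact: cvg_dotv.
have := @cvgD _ _ _ \oo eventually_filter _ _ _ _
  (cvg_scaled_remainder remP t0 tto0 dkd) cq.
rewrite add0r => lim; refine (cvg_to_ext _ lim) => k.
have t2 : t k != 0 by rewrite gt_eqF.
have dZ : 'd h x (t k *: dk k) = t k * 'd h x (dk k) by rewrite linearZ.
have qZ : quadf (hess h x) (t k *: dk k) = t k ^+ 2 * quadf (hess h x) (dk k).
  by rewrite !quadf_hess linearZ /= dotvZl dotvC dotvZl dotvC mulrA.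
rewrite /rem !fctE [x + _]addrC dZ qZ.
move: (h _) (h x) ('d h x _) (quadf _ _) => A B C D.
transitivity ((t k ^+ 2)^-1 * (A - B - t k * C - 2^-1 * (t k ^+ 2 * D)) + 2^-1 * D) => //.
by field.
Qed.

End Expansions.

(** * Derivatives of the Lagrangian *)

Section Lagrangian.
Variable R : realType.

Lemma diff_is_derive (V W : normedModType R) (F : V -> W) (x v : V) :
  differentiable F x -> is_derive x v F ('d F x v).
Proof. by move=> dF; split; [exact: diff_derivable|exact: deriveE]. Qed.

Lemma is_derive_diff (V W : normedModType R) (F : V -> W) (x v : V) (l : W) :
  differentiable F x -> is_derive x v F l -> 'd F x v = l.
Proof. by move=> dF Fl; rewrite -(@derive_val _ _ _ _ _ _ _ Fl); exact/esym/deriveE. Qed.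

(** Stated for a general codomain so that it applies to the Lagrangian and then to its gradient. *)
Lemma diff_add_sum (V W : normedModType R) m (F : V -> W) (G : 'I_m -> V -> W)
    (c : 'I_m -> R) (x v : V) :
  differentiable F x -> (forall i, differentiable (G i) x) ->
  'd (F + \sum_(i < m) c i \*: G i) x v = 'd F x v + \sum_(i < m) c i *: 'd (G i) x v.
Proof.
move=> dF dG; apply: is_derive_diff.
  by apply: differentiableD => //; apply: differentiable_sum => i; exact: differentiableZ.
apply: is_deriveD; first exact: diff_is_derive.
by apply: is_derive_sum => i; apply: is_deriveZ; exact: diff_is_derive.
Qed.

Lemma rV_fun_sum_delta (T : Type) m (g : T -> 'rV[R]_m) :
  g = \sum_(i < m) (fun x => g x 0 i *: (delta_mx 0 i : 'rV[R]_m)).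
Proof. by apply/funext => x; rewrite fct_sumE /= -row_sum_delta. Qed.

Lemma differentiable_rV n m (g : 'rV[R]_n -> 'rV[R]_m) x :
  (forall i, differentiable (compf g i) x) -> differentiable g x.
Proof.
move=> dg; rewrite [g]rV_fun_sum_delta; apply: differentiable_sum => i.
exact: (@differentiableZl _ _ _ (compf g i)).
Qed.

(** Both sides are limits of the same difference quotients along the steps 1/(k+1), and limits are
    unique. *)
Lemma diff_rV n m (g : 'rV[R]_n -> 'rV[R]_m) x v i :
  (forall i, differentiable (compf g i) x) -> 'd g x v 0 i = 'd (compf g i) x v.
Proof.
move=> dg.
have cv : (fun _ : nat => v) @ \oo --> v by exact: cvg_cst.
have h0 k : 0 < harmonic k :> R by rewrite invr_gt0.
have gv := cvg_diff_quotient (differentiable_rV dg) h0 cvg_harmonic cv.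
have giv := cvg_diff_quotient (dg i) h0 cvg_harmonic cv.
apply: (cvg_unique (@norm_hausdorff _ R^o) _ giv).
refine (cvg_to_ext _ (cvg_coord (i := i) gv)) => k.
by rewrite /compf !mxE.
Qed.

Variables (n m : nat) (f : 'rV[R]_n -> R) (g : 'rV[R]_n -> 'rV[R]_m).
Variable (lam : 'rV[R]_m).
Hypotheses (Cf : C2 f) (Cg : C2v g).

Let df x : differentiable f x. Proof. by case: Cf. Qed.
Let dgrf x : differentiable (grad f) x. Proof. by case: Cf => _ []. Qed.
Let dg i x : differentiable (compf g i) x. Proof. by case: (Cg i). Qed.
Let dgrg i x : differentiable (grad (compf g i)) x. Proof. by case: (Cg i) => _ []. Qed.

Lemma lagr_sum : lagr f g lam = f + \sum_(i < m) lam 0 i \*: compf g i.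
Proof.
apply/funext => x; rewrite /lagr /= fctE fct_sumE dotvC; congr (_ + _).
Qed.

Lemma diff_lagr x v : 'd (lagr f g lam) x v = 'd f x v + dotv lam ('d g x v).
Proof.
rewrite lagr_sum diff_add_sum //; congr (_ + _).
by apply: eq_bigr => i _; rewrite diff_rV.
Qed.

Lemma grad_lagr : grad (lagr f g lam) = grad f + \sum_(i < m) lam 0 i \*: grad (compf g i).
Proof.
apply/funext => x; rewrite fctE fct_sumE; apply/rowP => j.
rewrite !mxE diff_lagr summxE; congr (_ + _).
by apply: eq_bigr => i _; rewrite diff_rV // !mxE.
Qed.

Lemma quadf_hess_lagr x d :
  quadf (hess (lagr f g lam) x) d = quadf (hess f x) d + dotv lam (hessg g x d).
Proof.
have dotv0 : dotv 0 d = 0 by rewrite -(scale0r 0) dotvZl mul0r.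
apply: etrans (quadf_hess _ _ _) _; rewrite grad_lagr.
apply: etrans (congr1 (fun z => dotv z d) (diff_add_sum _ _ (dgrf x) (fun i => dgrg i x))) _.
rewrite dotvDl; congr (_ + _); first exact/esym/quadf_hess.
rewrite (big_morph (fun z => dotv z d) (fun u v => dotvDl u v d) dotv0).
apply: eq_bigr => i _; rewrite dotvZl mxE; congr (_ * _).
exact/esym/quadf_hess.
Qed.

End Lagrangian.

(** * Tangent directions and second-order tangents *)

Section Growth.
Variable R : realType.

(** The difference quotients of [g] serve as directions: they converge to g'(x) d and reproduce the
    points g(x + t_k d_k) of [K] exactly. *)
Lemma tcone_diff n m (g : 'rV[R]_n -> 'rV[R]_m) (K : set 'rV[R]_m) x d :
  differentiable g x -> tcone (feas g K) x d -> tcone K (g x) ('d g x d).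
Proof.
move=> dg [t [dk [t0 [tto0 [dkd Adk]]]]].
exists t, (fun k => (t k)^-1 *: (g (x + t k *: dk k) - g x)).
split=> //; split=> //; split; first exact: cvg_diff_quotient.
move=> k; rewrite scalerA divff ?gt_eqF // scale1r addrC subrK.
exact: Adk.
Qed.

(* The displacement is d plus a part v orthogonal to d.  Either v / t is bounded along
   a subsequence, whose limit is a second-order tangent, or v dominates t and its
   normalised limit is an asymptotic second-order tangent. *)
Lemma second_order_tangent n (A : set 'rV[R]_n) (x d : 'rV[R]_n) (D : 'rV[R]_n -> R)
    (t c : nat -> R) (dk : nat -> 'rV[R]_n) (c0 : R) :
  (forall a u, D (a *: u) = a * D u) -> continuous D ->
  (forall k, 0 < t k) -> t @ \oo --> (0 : R) -> dk @ \oo --> d ->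
  (forall k, dotv (dk k) d = dotv d d) -> (forall k, A (x + t k *: dk k)) ->
  c @ \oo --> c0 -> (forall k, D (dk k - d) <= t k * c k) ->
  (exists w, [/\ tcone2 A x d w, dotv w d = 0 & D w <= 2 * c0]) \/
  (exists w, [/\ tcone2a A x d w, dotv w d = 0, w != 0 & D w <= 0]).
Proof.
move=> DZ Dc t0 tto0 dkd dkp Adk cc0 Dle.
pose v k := dk k - d.
have vd k : dotv (v k) d = 0 by rewrite dotvDl dotvNl dkp subrr.
have xE k : x + t k *: dk k = x + t k *: d + t k *: v k.
  by rewrite /v scalerBr -addrA [t k *: d + _]addrC subrK.
have v0 : v @ \oo --> (0 : 'rV[R]_n).
  by rewrite -(subrr d); apply: cvgB => //; exact: cvg_cst.
(* Scaled so that (t^2 / 2) w = t v, the form required by [tcone2]. *)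
pose w k := (2 / t k) *: v k.
(* Either [w] stays in some ball infinitely often, or its norm tends to infinity. *)
have [[M wM]|/forallNP unb] :=
    pselect (exists M, forall N, exists k, (N <= k)%N /\ `|w k| <= M).
  have [p pP] := choice wM.
  have [q [l [qk wl]]] := @bounded_rV_cvg_subseq R n (w \o p) M (fun k => (pP k).2).
  pose s := p \o q.
  have sk k : (k <= s k)%N by exact: leq_trans (qk k) (pP (q k)).1.
  left; exists l; split.
  - exists (t \o s), (w \o s); split=> [k|]; first exact: t0.
    split; first exact: cvg_subseq tto0.
    split=> // k; rewrite /= scalerA.
    have -> : 2^-1 * t (s k) ^+ 2 * (2 / t (s k)) = t (s k).
      by field; rewrite gt_eqF.
    by rewrite -xE.
  - by apply: (dotv_cvg_eq0 _ wl) => k; rewrite /= dotvZl vd mulr0.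
  - have Dw : (fun k => D (w (s k))) @ \oo --> D l.
      exact: (cvg_comp (w \o s) D wl (Dc l)).
    have c2 : (fun k => 2 * c (s k)) @ \oo --> 2 * c0.
      by apply: cvgMl_tmp; exact: (cvg_subseq sk cc0).
    apply: (ler_cvg_to Dw c2); near=> k.
    rewrite DZ -mulrA ler_pM2l // ler_pdivrMl //.
    exact: Dle.
have {}unb M : exists N, forall k, (N <= k)%N -> M < `|w k|.
  have /existsNP[N /forallNP NP] := unb M.
  exists N => k Nk; rewrite ltNge; apply/negP => wM.
  exact: (NP k).
(* Beyond this [N] no [v k] vanishes, so normalising is legitimate. *)
have [N wN] := unb 0.
have vN k : 0 < `|v (k + N)%N|.
  have := wN (k + N)%N (leq_addl _ _); rewrite !normr_gt0.
  by apply: contra => /eqP vkN; rewrite /w vkN scaler0.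
pose e k := `|v (k + N)%N|^-1 *: v (k + N)%N.
have e1 k : `|e k| = 1 by rewrite normrZ normfV normr_id mulVf // gt_eqF.
have el1 k : `|e k| <= 1 by rewrite e1.
have [q [l [qk el]]] := bounded_rV_cvg_subseq el1.
pose s k := (q k + N)%N.
have sk k : (k <= s k)%N by rewrite (leq_trans (qk k)) // leq_addr.
have vs0 k : 0 < `|v (s k)| by exact: vN.
(* The quotient is the inverse of the norm of [w], which tends to infinity. *)
have tv0 : (fun k => t (s k) / (2 * `|v (s k)|)) @ \oo --> (0 : R).
  apply/cvgr0Pnorm_le => a a0.
  have [N' N'P] := unb a^-1.
  exists N' => // k /= N'k.
  have := N'P _ (leq_trans N'k (sk k)).
  rewrite normrZ gtr0_norm ?divr_gt0 // => /ltW wa.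
  rewrite gtr0_norm ?divr_gt0 ?mulr_gt0 //.
  rewrite ler_pdivrMr ?mulr_gt0 // -ler_pdivrMl //.
  by move: wa; rewrite mulrAC ler_pdivlMr.
right; exists l; split.
(* With r = 2 |v| and the unit vector e = v / |v|, the term (t r / 2) e is again t v. *)
- exists (t \o s), (fun k => 2 * `|v (s k)|), (e \o q); split=> [k|]; first exact: t0.
  split=> [k|]; first by rewrite mulr_gt0.
  split; first exact: cvg_subseq tto0.
  split.
    rewrite -(mulr0 2); apply: cvgMl_tmp; rewrite -(normr0 'rV[R]_n).
    by apply: cvg_norm; exact: (cvg_subseq sk v0).
  split=> //; split=> // k; rewrite /= scalerA -/(s k).
  have -> : 2^-1 * t (s k) * (2 * `|v (s k)|) * `|v (s k)|^-1 = t (s k).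
    by field; rewrite gt_eqF.
  by rewrite -xE.
- by apply: (dotv_cvg_eq0 _ el) => k; rewrite /= dotvZl vd mulr0.
- have l1 : (1 : R) <= `|l|.
    by apply: (cvgr_to_ge (cvg_norm el)); apply: nearW => k; rewrite /= e1.
  by rewrite -normr_gt0 (lt_le_trans _ l1).
- have De : (fun k => D (e (q k))) @ \oo --> D l by exact: (cvg_comp (e \o q) D el (Dc l)).
  (* The bound D v <= t c divided by |v| reads D e <= (t / (2 |v|)) (2 c), whose right side tends to
     0. *)
  have cs : (fun k => t (s k) / (2 * `|v (s k)|) * (2 * c (s k))) @ \oo --> 0 * (2 * c0).
    by apply: cvgM => //; apply: cvgMl_tmp; exact: (cvg_subseq sk cc0).
  rewrite -(mul0r (2 * c0)); apply: (ler_cvg_to De cs); near=> k.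
  rewrite DZ -/(s k) ler_pdivrMl //; apply: le_trans (Dle _) _.
  rewrite le_eqVlt; apply/orP; left; apply/eqP.
  by field; rewrite gt_eqF.
Unshelve. all: by end_near. Qed.

End Growth.

(** * Sufficient conditions for quadratic growth on a set *)

Section QuadraticGrowth.
Variables (R : realType) (n : nat).

(** The multiplier-free core of the theorem: the conditions involve only the objective and the
    feasible set. Failure of growth is turned into a sequence whose second-order expansion
    contradicts them. *)
Lemma quadratic_growth (h : 'rV[R]_n -> R) (A : set 'rV[R]_n) (x : 'rV[R]_n) :
  C2 h -> (forall d, tcone A x d -> 0 <= 'd h x d) ->
  (forall d, tcone A x d -> 'd h x d <= 0 -> d != 0 ->
    (forall w, tcone2a A x d w -> dotv w d = 0 -> w != 0 -> 0 < 'd h x w) /\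
    (forall w, tcone2 A x d w -> dotv w d = 0 ->
       0 < quadf (hess h x) d + 'd h x w)) ->
  exists kappa delta : R, 0 < kappa /\ 0 < delta /\
    forall y, A y -> `|y - x| <= delta -> h x + kappa * `|y - x| ^+ 2 <= h y.
Proof.
move=> Ch first_order second_order; apply: contrapT => nogrowth.
have dh : differentiable h x by case: Ch.
have DZ a u : 'd h x (a *: u) = a * 'd h x u by rewrite linearZ.
have DB u v : 'd h x (u - v) = 'd h x u - 'd h x v by rewrite linearB.
have harm0 k : 0 < harmonic k :> R by rewrite invr_gt0.
(* Failure of growth is used with [kappa] and [delta] both equal to 1/(k+1). *)
have y_ex k : exists y, [/\ A y, `|y - x| <= harmonic k &
    h y < h x + harmonic k * `|y - x| ^+ 2].
  apply: contrapT => /forallNP noy; apply: nogrowth.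
  exists (harmonic k), (harmonic k); split=> //; split=> // y Ay yx.
  by rewrite leNgt; apply/negP => hy; exact: (noy y).
have [y yP] := choice y_ex.
(* If y_k = x, the strict inequality would read h(x) < h(x). *)
have yx0 k : 0 < `|y k - x|.
  rewrite normr_gt0; apply/eqP => yx; have [_ _] := yP k.
  by rewrite yx normr0 expr0n mulr0 addr0 -(subrK x (y k)) yx add0r ltxx.
pose e k := `|y k - x|^-1 *: (y k - x).
have e1 k : `|e k| = 1 by rewrite normrZ normfV normr_id mulVf // gt_eqF.
have ele1 k : `|e k| <= 1 by rewrite e1.
have [p [d [pk dkd]]] := bounded_rV_cvg_subseq ele1.
pose t k := `|y (p k) - x|.
pose dk k := (t k)^-1 *: (y (p k) - x).
have t0 k : 0 < t k by exact: yx0.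
have tdk k : x + t k *: dk k = y (p k).
  by rewrite scalerA divff ?gt_eqF // scale1r addrC subrK.
have hp0 : (fun k => harmonic (p k)) @ \oo --> (0 : R).
  exact: (cvg_subseq pk cvg_harmonic).
have tto0 : t @ \oo --> (0 : R).
  apply: (squeeze_cvgr _ (cvg_cst 0) hp0); near=> k.
  by rewrite ltW //=; have [] := yP (p k).
have d0 : d != 0.
  have d1 : (1 : R) <= `|d|.
    by apply: (cvgr_to_ge (cvg_norm dkd)); apply: nearW => k; rewrite /= e1.
  by rewrite -normr_gt0 (lt_le_trans _ d1).
have hle k : h (x + t k *: dk k) - h x <= harmonic (p k) * t k ^+ 2.
  by rewrite tdk lerBlDl ltW //; have [] := yP (p k).
have Td : tcone A x d.
  exists t, dk; split=> //; split=> //; split=> // k.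
  by rewrite tdk; have [] := yP (p k).
have Dd0 : 'd h x d <= 0.
  have ht : (fun k => harmonic (p k) * t k) @ \oo --> 0 * (0 : R) by exact: cvgM.
  rewrite -[leRHS](mulr0 0); apply: (ler_cvg_to (cvg_diff_quotient dh t0 tto0 dkd) ht).
  near=> k; rewrite [_ *: _]/(_ * _) ler_pdivrMl // mulrCA -expr2.
  exact: hle.
have [asym second] := second_order d Td Dd0 d0.
have dd0 := dotv_gt0 d0.
(* Dividing the direction by [a] makes its component along [d] exactly [d], so the rest is
   orthogonal to [d]; multiplying the step by [a] keeps the point unchanged. As [a] tends to 1, it
   is positive after a shift by [N]. *)
pose a k := dotv (dk k) d / dotv d d.
have a1 : a @ \oo --> (1 : R).
  rewrite -(divff (lt0r_neq0 dd0)); apply: cvgMr_tmp.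
  by apply: cvg_dotv => //; exact: cvg_cst.
have [N _ aN] : \forall k \near \oo, 0 < a k by exact: cvgr_gt a1 _ ltr01.
pose s k := (k + N)%N.
have sk k : (k <= s k)%N by exact: leq_addr.
have as0 k : 0 < a (s k) by apply: aN; rewrite /= leq_addl.
pose tau k := t (s k) * a (s k).
pose dl k := (a (s k))^-1 *: dk (s k).
have tau0 k : 0 < tau k by rewrite mulr_gt0.
have tdl k : tau k *: dl k = t (s k) *: dk (s k).
  by rewrite scalerA /tau mulfK // gt_eqF.
have as1 : (fun k => a (s k)) @ \oo --> (1 : R) by exact: (cvg_subseq sk a1).
have ias1 : (fun k => (a (s k))^-1) @ \oo --> (1 : R).
  by rewrite -invr1; apply: cvgV => //; exact: oner_neq0.
have tauto0 : tau @ \oo --> (0 : R).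
  by rewrite -(mul0r 1); apply: cvgM => //; exact: (cvg_subseq sk tto0).
have dld : dl @ \oo --> d.
  by rewrite -(scale1r d); apply: cvgZ => //; exact: (cvg_subseq sk dkd).
have dlp k : dotv (dl k) d = dotv d d.
  rewrite dotvZl; have := as0 k; rewrite /a; move: (dotv (dk _) d) => z z0.
  have zn : z != 0 by apply/eqP => ze; move: z0; rewrite ze mul0r ltxx.
  by field; rewrite zn gt_eqF.
have Adl k : A (x + tau k *: dl k).
  by rewrite tdl tdk; have [] := yP (p (s k)).
pose rho k := (tau k ^+ 2)^-1 *
  (h (x + tau k *: dl k) - h x - tau k * 'd h x (dl k)).
have rhoc : rho @ \oo --> 2^-1 * quadf (hess h x) d by exact: cvg_diff2_quotient.
(* Obtained by inserting the expansion tau h'(x) dl + tau^2 rho into the bound [hle] and dividing by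
   tau^2, where t^2 / tau^2 = a^-2. Its limit is -h''(x)(d,d) / 2. *)
pose c k := harmonic (p (s k)) * ((a (s k))^-1 * (a (s k))^-1) - rho k.
have cc0 : c @ \oo --> 0 * (1 * 1) - 2^-1 * quadf (hess h x) d.
  apply: cvgB => //; apply: cvgM; first exact: (cvg_subseq sk hp0).
  exact: cvgM.
have Dle k : 'd h x (dl k - d) <= tau k * c k.
  (* Subtracting [d] can only lower the value, since h'(x) d >= 0 on the tangent cone. *)
  have Ddl : 'd h x (dl k - d) <= 'd h x (dl k).
    by rewrite DB gerBl; exact: first_order.
  apply: le_trans Ddl _.
  have ak := lt0r_neq0 (as0 k); have tk := lt0r_neq0 (t0 (s k)).
  rewrite -(ler_pM2l (tau0 k)).
  have -> : tau k * (tau k * c k) = harmonic (p (s k)) * t (s k) ^+ 2 -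
      (h (x + tau k *: dl k) - h x - tau k * 'd h x (dl k)).
    rewrite /c /rho; move: (h (x + _)) ('d h x _) (harmonic _) => X Y Z.
    rewrite /tau; field.
    by rewrite ak tk.
  have := hle (s k); rewrite -tdl.
  by move: (h (x + _)) ('d h x _) (harmonic _ * _) => X Y Z; lra.
have Dc : continuous ('d h x) by exact: diff_continuous.
(* In the first case h'(x) w <= -h''(x)(d,d), in the second h'(x) w <= 0 with w nonzero; each
   contradicts the second-order hypothesis. *)
have [[w [Tw wd Dw]]|[w [Tw wd w0 Dw]]] :=
    second_order_tangent DZ Dc tau0 tauto0 dld dlp Adl cc0 Dle.
  have := second w Tw wd; move: Dw.
  by move: ('d h x w) (quadf _ _) => X Y; lra.
by have := asym w Tw wd w0; rewrite ltNge Dw.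
Unshelve. all: by end_near. Qed.

End QuadraticGrowth.

(** * From multiplier conditions to weak sharpness *)

Unset Implicit Arguments.
Set Strict Implicit.

Theorem theorem4p6 (R : realType) (n m : nat)
  (f : 'rV[R]_n -> R) (g : 'rV[R]_n -> 'rV[R]_m) (K : set 'rV[R]_m)
  (xb : 'rV[R]_n) :
  C2 f -> C2v g -> closed K ->
  optset f g K xb ->
  (* xb is an isolated point of S *)
  (exists eps : R, 0 < eps /\
     forall x, optset f g K x -> `|x - xb| < eps -> x = xb) ->
  (forall d, tcone (feas g K) xb d -> 0 <= 'd f xb d) ->
  (exists lam : 'rV[R]_m,
     grad (lagr f g lam) xb = 0 /\
     forall d, critcone f g K xb d -> d != 0 ->
       (forall w, tcone2a (feas g K) xb d w -> dotv w d = 0 -> w != 0 ->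
          dotv lam ('d g xb w) < 0) /\
       (0 < (quadf (hess (lagr f g lam) xb) d)%:E -
            suppf [set ('d g xb w + hessg g xb d)%R | w in
                     [set w | tcone2 (feas g K) xb d w /\ dotv w d = 0%R]] lam)%E) ->
  wsharp2 f g K xb.
Proof.
move=> Cf Cg _ optxb _ first_order [lam [gradL0 second_order]].
have dg i : differentiable (compf g i) xb by case: (Cg i).
have Df w : 'd f xb w = - dotv lam ('d g xb w).
  apply/eqP; rewrite -subr_eq0 opprK; apply/eqP.
  apply: etrans (esym (diff_lagr lam Cf Cg xb w)) _.
  apply: etrans (diff_dotv_grad _ _ _) _.
  by rewrite gradL0 -(scale0r 0) dotvZl mul0r.
split; first by case: optxb.
have [d Td Dd0 d0|kappa [delta [kappa0 [delta0 growth]]]] :=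
    quadratic_growth Cf first_order.
  have [|asym second] := second_order d _ d0.
    by split=> //; apply: tcone_diff => //; exact: differentiable_rV.
  split=> [w Tw wd w0|w Tw wd]; first by rewrite Df oppr_gt0; exact: asym.
  move: second; rewrite sube_gt0 => second.
  (* The supremum in (ii) dominates its term at [w]; the contribution of g''(d,d) then cancels
     against the one in the Hessian of the Lagrangian. *)
  have : ((dotv lam ('d g xb w + hessg g xb d))%:E <
      (quadf (hess f xb) d + dotv lam (hessg g xb d))%:E)%E.
    apply: (@le_lt_trans _ _ _ _ _ _ (lt_le_trans second _)).
      by apply: ereal_sup_ubound; exists ('d g xb w + hessg g xb d) => //; exists w.
    rewrite lee_fin le_eqVlt; apply/orP; left; apply/eqP; exact: quadf_hess_lagr.
  rewrite lte_fin dotvC dotvDl [dotv ('d g xb w) _]dotvC [dotv (hessg g xb d) _]dotvC.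
  by rewrite ltrD2r Df subr_gt0.
exists kappa, delta; split=> //; split=> // x feasx xd.
apply: le_trans (growth x feasx xd); rewrite lerD2l ler_pM2l //.
(* Since [xb] lies in the optimal set, the distance to that set is at most |x - xb|. Comparing
   squares also requires the distance to be nonnegative, which this lower bound gives. *)
have inf0 : lbound [set `|x - y| | y in optset f g K] 0 by move=> _ [y _ <-].
apply: lerXn2r; rewrite ?nnegrE //.
  by apply: lb_le_inf => //; exists `|x - xb|, xb.
by apply: ge_inf; [exists 0|exists xb].
Qed.
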